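(* Fix an integer $n\ge 16$. Let $N$ be the largest cardinality of a sum-dominant subset of $\{0,1,\ldots,n-1\}$ that contains both $0$ and $n-1$. Then $n-7\le N\le n-4$.
   Context: For a finite set $A\subseteq\mathbb{N}$, define the sum set $A+A=\{a_i+a_j : a_i,a_j\in A\}$ and the difference set $A-A=\{a_i-a_j : a_i,a_j\in A\}$. The set $A$ is called sum-dominant if $|A+A|>|A-A|$. *)

(* Defs.v *)
From mathcomp Require Import all_boot all_order all_algebra finmap.

Set Implicit Arguments.
Unset Strict Implicit.
Unset Printing Implicit Defensive.

Local Open Scope fset_scope.

Definition sumset (A : {fset nat}) : {fset nat} :=
  [fset (a + b)%N | a in A, b in A].

(* The differences are signed integers: on nat, subtraction would truncate. *)
Definition diffset (A : {fset nat}) : {fset int} :=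
  [fset (a%:Z - b%:Z)%R | a in A, b in A].

Definition sum_dominant (A : {fset nat}) : Prop :=
  (#|` diffset A | < #|` sumset A |)%N.

Definition full_span_sum_dominant (n : nat) (A : {fset nat}) : Prop :=
  [/\ (forall a : nat, a \in A -> (a < n)%N),
      0%N \in A, n.-1 \in A & sum_dominant A].

Definition largest_card (n N : nat) : Prop :=
  (exists2 A : {fset nat}, full_span_sum_dominant n A & #|` A | = N) /\
  (forall A : {fset nat}, full_span_sum_dominant n A -> (#|` A | <= N)%N).

(* Main.v *)
Require Import Defs.
From mathcomp Require Import all_boot all_order all_algebra finmap.
From mathcomp Require Import zify.

(** Let [A] be obtained from [[0, n-1]] by deleting [k] points other than [0]
    and [n-1].

    Upper bound.  If [k <= 3], every difference [d <= n-4] is realised, as it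
    has four pairwise disjoint representations.  Thus only [n-2] and [n-3] can
    be lost, and not both, since that would cost four points.  Losing [n-2]
    forces [1] and [n-2] out of [A], which loses the sums [1] and [2n-3];
    losing [n-3] forces [2], [n-3] and one of [1], [n-2] out of [A], which
    loses the sums [1], [2] or [2n-4], [2n-3].  So at least as many sums as
    differences are lost.

    Lower bound.  Deleting [2, 4, 5, 6, n-7, n-6, n-4] loses only the sum [5]
    but both differences [n-7] and [-(n-7)]. *)

(** * Membership in sum and difference sets *)

Lemma mem_sumset (A : {fset nat}) (a b : nat) :
  a \in A -> b \in A -> a + b \in sumset A.
Proof. by move=> Aa Ab; apply/imfset2P; exists a => //; exists b. Qed.

Lemma mem_sumset_sub (A : {fset nat}) (a s : nat) :
  a <= s -> a \in A -> s - a \in A -> s \in sumset A.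
Proof. by move=> le_as Aa As; rewrite -(subnKC le_as) mem_sumset. Qed.

Lemma sumsetP (A : {fset nat}) (s : nat) :
  reflect (exists a b, [/\ a \in A, b \in A & s = a + b]) (s \in sumset A).
Proof.
apply: (iffP idP) => [/imfset2P[a /= Aa [b /= Ab ->]]|[a [b [Aa Ab ->]]]].
  by exists a, b.
exact: mem_sumset.
Qed.

Lemma mem_diffset (A : {fset nat}) (a b : nat) :
  a \in A -> b \in A -> (a%:Z - b%:Z)%R \in diffset A.
Proof. by move=> Aa Ab; apply/imfset2P; exists a => //; exists b. Qed.

Lemma diffsetP (A : {fset nat}) (z : int) :
  reflect (exists a b, [/\ a \in A, b \in A & z = (a%:Z - b%:Z)%R])
          (z \in diffset A).
Proof.
apply: (iffP idP) => [/imfset2P[a /= Aa [b /= Ab ->]]|[a [b [Aa Ab ->]]]].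
  by exists a, b.
exact: mem_diffset.
Qed.

(** * Counting differences and sums against the full range *)

(** The difference set is symmetric under negation, so differences can be tracked by absolute value,
    within [nat]. *)
Definition has_diff (A : {fset nat}) (d : nat) : Prop :=
  exists2 a, a \in A & a + d \in A.

Lemma has_diff_mem (A : {fset nat}) (z : int) :
  has_diff A `|z|%N -> z \in diffset A.
Proof.
case=> a Aa Aaz; apply/diffsetP.
have [z_ge0|z_lt0] : (0 <= z)%R \/ (z < 0)%R by lia.
  by exists (a + `|z|%N), a; split=> //; lia.
by exists a, (a + `|z|%N); split=> //; lia.
Qed.

(** The largest difference set that a subset of [[0, n-1]] can have. *)
Definition int_range (n : nat) : seq int :=
  [seq (i%:Z - n.-1%:Z)%R | i <- iota 0 (2 * n).-1].

Lemma mem_int_range (n : nat) (z : int) :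
  (z \in int_range n) = (`|z| < n)%N.
Proof.
apply/mapP/idP => [[i]|z_lt_n]; first by rewrite mem_iota; lia.
by exists `|(z + n.-1%:Z)%R|%N; rewrite ?mem_iota; lia.
Qed.

Lemma size_int_range (n : nat) : size (int_range n) = (2 * n).-1.
Proof. by rewrite size_map size_iota. Qed.

Lemma int_range_uniq (n : nat) : uniq (int_range n).
Proof. by rewrite map_inj_uniq ?iota_uniq // => i j; lia. Qed.

Lemma card_diffset_full (n : nat) (A : {fset nat}) :
  (forall d, d < n -> has_diff A d) -> (2 * n).-1 <= #|` diffset A|.
Proof.
move=> hA; rewrite -size_int_range; apply: uniq_leq_size (int_range_uniq n) _.
by move=> z; rewrite mem_int_range => /hA; apply: has_diff_mem.
Qed.

Lemma card_diffset_but_one (n : nat) (A : {fset nat}) (e : nat) :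
  (forall d, d < n -> d != e -> has_diff A d) ->
  (2 * n).-1 <= #|` diffset A| + 2.
Proof.
move=> hA; rewrite -size_int_range addn2.
apply: (uniq_leq_size (s2 := [:: (e%:Z)%R, (- e%:Z)%R & enum_fset (diffset A)])).
  exact: int_range_uniq.
move=> z; rewrite mem_int_range !in_cons => z_lt_n.
have [z_e|/(hA _ z_lt_n) /has_diff_mem Dz] := eqVneq `|z|%N e.
  have [->|->] : z = (e%:Z)%R \/ z = (- e%:Z)%R by lia.
    by rewrite eqxx.
  by rewrite eqxx orbT.
by rewrite Dz !orbT.
Qed.

(** A missing [e] takes [-e] with it, and these are distinct because [0 < e]. *)
Lemma card_diffset_lost (n : nat) (A : {fset nat}) (e : nat) :
    (forall a, a \in A -> a < n) -> 0 < e < n -> ~ has_diff A e ->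
  #|` diffset A| + 2 <= (2 * n).-1.
Proof.
move=> ltA e_range noe; rewrite -size_int_range addn2.
have D_e : ((e%:Z)%R \in diffset A) = false.
  apply/negP => /diffsetP[a [b [Aa Ab e_ab]]]; apply: noe.
  by exists b => //; have -> : b + e = a by lia.
have D_Ne : ((- e%:Z)%R \in diffset A) = false.
  apply/negP => /diffsetP[a [b [Aa Ab e_ab]]]; apply: noe.
  by exists a => //; have -> : a + e = b by lia.
apply: (uniq_leq_size (s1 := [:: (e%:Z)%R, (- e%:Z)%R & enum_fset (diffset A)])).
  by rewrite /= in_cons D_e D_Ne fset_uniq andbT orbF; lia.
move=> z; rewrite mem_int_range !in_cons => /or3P[/eqP->|/eqP->|]; try lia.
by move=> /diffsetP[a [b [/ltA ? /ltA ? ->]]]; lia.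
Qed.

Lemma card_sumset_le (n : nat) (A : {fset nat}) :
  (forall a, a \in A -> a < n) -> #|` sumset A| <= (2 * n).-1.
Proof.
move=> ltA; rewrite -(size_iota 0 (2 * n).-1).
apply: uniq_leq_size (fset_uniq _) _ => s /sumsetP[a [b [/ltA ? /ltA ? ->]]].
by rewrite mem_iota; lia.
Qed.

Lemma card_sumset_lost2 (n : nat) (A : {fset nat}) (s t : nat) :
    (forall a, a \in A -> a < n) -> s < t < (2 * n).-1 ->
    s \notin sumset A -> t \notin sumset A ->
  #|` sumset A| + 2 <= (2 * n).-1.
Proof.
move=> ltA st_range Ss St; rewrite -[leqRHS](size_iota 0) addn2.
apply: (uniq_leq_size (s1 := [:: s, t & enum_fset (sumset A)])).
  by rewrite /= in_cons (negPf Ss) (negPf St) fset_uniq andbT orbF; lia.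
move=> x; rewrite mem_iota !in_cons => /or3P[/eqP->|/eqP->|]; try lia.
by move=> /sumsetP[a [b [/ltA ? /ltA ? ->]]]; lia.
Qed.

Lemma card_sumset_but_one (m : nat) (A : {fset nat}) (s : nat) :
  (forall x, x < m -> x != s -> x \in sumset A) -> m <= #|` sumset A|.+1.
Proof.
move=> hA; rewrite -[leqLHS](size_iota 0).
apply: (uniq_leq_size (s2 := s :: enum_fset (sumset A)) (iota_uniq _ _)).
move=> x; rewrite mem_iota in_cons => /hA x_sum.
by have [//|/x_sum ->] := eqVneq x s; rewrite orbT.
Qed.

(** * Pigeonhole on the missing points *)

Lemma card_missing (n : nat) (A : {fset nat}) (s : seq nat) :
    uniq s -> (forall a, a \in A -> a < n) ->
    {in s, forall x, x < n /\ x \notin A} ->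
  #|` A| + size s <= n.
Proof.
move=> s_uniq ltA s_out; rewrite -size_cat -[leqRHS](size_iota 0).
apply: uniq_leq_size => [|x].
  rewrite cat_uniq fset_uniq s_uniq andbT /=.
  by apply/hasPn => x /s_out[].
by rewrite mem_cat mem_iota /= => /orP[/ltA|/s_out[]].
Qed.

(* If [d] is not realised, each pair [{u, u + d}] with [u] in [s] contains a
   point outside [A], and these points are distinct. *)
Lemma has_diff_disjoint (n : nat) (A : {fset nat}) (d : nat) (s : seq nat) :
    (forall a, a \in A -> a < n) -> n < #|` A| + size s -> uniq s ->
    {in s, forall u, u + d < n} -> {in s &, forall u v, u + d != v} ->
  has_diff A d.
Proof.
move=> ltA s_big s_uniq s_lt disj.
have [/hasP[u _ /andP[Au Aud]]|/hasPn no_d] :=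
  boolP (has (fun u => (u \in A) && (u + d \in A)) s); first by exists u.
pose f u := if u \in A then u + d else u.
have f_out u : u \in s -> f u \notin A.
  by rewrite /f => /no_d; case: ifP => //= ->.
have f_inj : {in s &, injective f}.
  move=> u v su sv; have uv := disj _ _ su sv; have vu := disj _ _ sv su.
  by rewrite /f; case: (u \in A); case: (v \in A); lia.
have f_uniq : uniq [seq f u | u <- s] by rewrite map_inj_in_uniq.
exfalso; suff : #|` A| + size [seq f u | u <- s] <= n
  by rewrite size_map leqNgt s_big.
apply: card_missing f_uniq ltA _ => _ /mapP[u su ->].
split; last exact: f_out.
by have := s_lt u su; rewrite /f; case: ifP => _; lia.
Qed.

(** * Upper bound: at most three missing points *)

Section UpperBound.

Variables (n : nat) (A : {fset nat}).
Hypotheses (n_ge : 10 <= n) (ltA : forall a, a \in A -> a < n).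
Hypotheses (A0 : 0 \in A) (A1 : n.-1 \in A) (cardA : n - 4 < #|` A|).

Lemma no_four_missing (x y z t : nat) :
    [&& x < n, y < n, z < n & t < n] -> uniq [:: x; y; z; t] ->
  [|| x \in A, y \in A, z \in A | t \in A].
Proof.
move=> /and4P[xn yn zn tn] xyzt_uniq; apply/negP => /negP.
rewrite !negb_or => /and4P[xA yA zA tA].
suff : #|` A| + 4 <= n by lia.
apply: card_missing xyzt_uniq ltA _ => u.
by rewrite !inE => /or4P[] /eqP->.
Qed.

(** Four disjoint pairs [{u, u + d}] cannot all be hit by three missing points. For [4 <= d] the
    starts 0 to 3 serve, and [d <= n - 4] keeps [3 + d] in range. Smaller [d] need spaced starts;
    the largest endpoint, [6 + 3], accounts for [10 <= n]. *)
Lemma has_diff_small (d : nat) : d <= n - 4 -> has_diff A d.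
Proof.
move=> d_le; have cardA4 : n < #|` A| + 4 by lia.
case: (posnP d) => [->|d_gt0]; first by exists 0.
have [d1|[d2|[d3|d_ge4]]] : d = 1 \/ (d = 2 \/ (d = 3 \/ 4 <= d)) by lia.
- apply: (@has_diff_disjoint n A d [:: 0; 2; 4; 6]) => //.
    by move=> u; rewrite !inE; lia.
  by move=> u v; rewrite !inE; lia.
- apply: (@has_diff_disjoint n A d [:: 0; 1; 4; 5]) => //.
    by move=> u; rewrite !inE; lia.
  by move=> u v; rewrite !inE; lia.
- apply: (@has_diff_disjoint n A d [:: 0; 1; 2; 6]) => //.
    by move=> u; rewrite !inE; lia.
  by move=> u v; rewrite !inE; lia.
- apply: (@has_diff_disjoint n A d [:: 0; 1; 2; 3]) => //.
    by move=> u; rewrite !inE; lia.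
  by move=> u v; rewrite !inE; lia.
Qed.

Lemma not_sum_dominant : ~ sum_dominant A.
Proof.
rewrite /sum_dominant => dom.
have sum_le := card_sumset_le n A ltA.
have out2 x y : x \notin A -> y \in A -> x != y.
  by move=> xA yA; apply: contraNneq xA => ->.
have d_last : has_diff A n.-1 by exists 0.
have split_d d : d < n -> d != n - 2 -> d != n - 3 -> has_diff A d.
  move=> d_lt d2 d3.
  have [->//|d_le] : d = n.-1 \/ d <= n - 4 by lia.
  exact: has_diff_small.
(* The representations of [n-2] are [(n-2) - 0] and [(n-1) - 1]; those of [n-3] are [(n-3) - 0],
   [(n-2) - 1] and [(n-1) - 2]. *)
have d_n2 : 1 \in A \/ n - 2 \in A -> has_diff A (n - 2).
  case=> [i1|i2]; last by exists 0.
  by exists 1 => //; have -> : 1 + (n - 2) = n.-1 by lia.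
have d_n3 : [|| 2 \in A, n - 3 \in A | (1 \in A) && (n - 2 \in A)] ->
    has_diff A (n - 3).
  case/or3P=> [i2|i3|/andP[i1 i2]]; last 1 first.
  - by exists 1 => //; have -> : 1 + (n - 3) = n - 2 by lia.
  - by exists 2 => //; have -> : 2 + (n - 3) = n.-1 by lia.
  - by exists 0.
(* The sum 1 arises only as [0 + 1], and 2 only as [0 + 2] or [1 + 1]. [sum_hi] is the mirror image
   under [x -> n-1-x]. *)
have sum_lo s : 1 \notin A -> s = 1 \/ s = 2 /\ 2 \notin A ->
    s \notin sumset A.
  move=> o1 sE; apply/negP => /sumsetP[a [b [Aa Ab s_ab]]].
  have a1 := out2 _ _ o1 Aa; have b1 := out2 _ _ o1 Ab.
  case: sE => [sE|[sE o2]]; first by lia.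
  by have a2 := out2 _ _ o2 Aa; have b2 := out2 _ _ o2 Ab; lia.
have sum_hi s : n - 2 \notin A ->
    s = 2 * n - 3 \/ s = 2 * n - 4 /\ n - 3 \notin A -> s \notin sumset A.
  move=> o1 sE; apply/negP => /sumsetP[a [b [Aa Ab s_ab]]].
  have a1 := out2 _ _ o1 Aa; have b1 := out2 _ _ o1 Ab.
  have a_lt := ltA _ Aa; have b_lt := ltA _ Ab.
  case: sE => [sE|[sE o2]]; first by lia.
  by have a2 := out2 _ _ o2 Aa; have b2 := out2 _ _ o2 Ab; lia.
(* This is what prevents [n-2] and [n-3] from being lost together. *)
have four : [|| 1 \in A, n - 2 \in A, 2 \in A | n - 3 \in A].
  by apply: no_four_missing; rewrite /= ?inE; lia.
have [h2|] := boolP ((1 \in A) || (n - 2 \in A)); last first.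
  rewrite negb_or => /andP[o1 o2].
  have diff_ge : (2 * n).-1 <= #|` diffset A| + 2.
    apply: (@card_diffset_but_one n A (n - 2)) => d d_lt d_neq.
    have [->|d3] := eqVneq d (n - 3); last exact: split_d.
    by apply: d_n3; move: four; rewrite (negPf o1) (negPf o2) /= orbF.
  have : #|` sumset A| + 2 <= (2 * n).-1; last lia.
  by apply: (@card_sumset_lost2 n A 1 (2 * n - 3)) => //;
     [lia|apply: sum_lo => //; left|apply: sum_hi => //; left].
have {}d_n2 : has_diff A (n - 2) by apply: d_n2; apply/orP.
have [h3|] :=
  boolP [|| 2 \in A, n - 3 \in A | (1 \in A) && (n - 2 \in A)].
  (* Here every difference occurs, so there are at least [2n-1] of them, while there are at most
     [2n-1] sums. *)
  have := @card_diffset_full n A; suff hA d : d < n -> has_diff A d.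
    by move/(_ hA); lia.
  move=> d_lt; have [->//|d2] := eqVneq d (n - 2).
  by have [->|d3] := eqVneq d (n - 3); [apply: d_n3|apply: split_d].
rewrite !negb_or negb_and => /and3P[o2 o3 o].
have diff_ge : (2 * n).-1 <= #|` diffset A| + 2.
  apply: (@card_diffset_but_one n A (n - 3)) => d d_lt d_neq.
  by have [->//|d2] := eqVneq d (n - 2); apply: split_d.
have : #|` sumset A| + 2 <= (2 * n).-1; last lia.
(* The end at which the second point is missing is the end that loses two sums. *)
case/orP: o => [o1|o1].
  by apply: (@card_sumset_lost2 n A 1 2) => //;
     [lia|apply: sum_lo => //; left|apply: sum_lo => //; right].
by apply: (@card_sumset_lost2 n A (2 * n - 4) (2 * n - 3)) => //;
   [lia|apply: sum_hi => //; right|apply: sum_hi => //; left].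
Qed.

End UpperBound.

(** * Lower bound: a sum-dominant set with seven points deleted *)

(** Each deleted point destroys one of the seven pairs [{a, a + (n-7)}], [a <= 6]: the pairs with
    [a] = 2, 4, 5, 6 at the lower end, those with [a] = 0, 1, 3 at the upper end. *)
Definition witness (n : nat) : {fset nat} :=
  [fset x in iota 0 n | x \notin [:: 2; 4; 5; 6; n - 7; n - 6; n - 4]]%fset.

Lemma mem_witness (n x : nat) :
  (x \in witness n) =
  (x < n) && (x \notin [:: 2; 4; 5; 6; n - 7; n - 6; n - 4]).
Proof. by rewrite !inE mem_iota. Qed.

Lemma card_witness (n : nat) : n - 7 <= #|` witness n|.
Proof.
pose s := [:: 2; 4; 5; 6; n - 7; n - 6; n - 4].
suff : n <= size (s ++ enum_fset (witness n)) by rewrite size_cat /=; lia.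
rewrite -[leqLHS](size_iota 0); apply: uniq_leq_size (iota_uniq _ _) _ => x.
rewrite mem_iota mem_cat => x_lt.
have -> : (x \in enum_fset (witness n)) = (x \in witness n) by [].
by rewrite mem_witness; case: (x \in s) => //=; rewrite andbT.
Qed.

Lemma witness_sum (n s : nat) :
  16 <= n -> s < (2 * n).-1 -> s != 5 -> s \in sumset (witness n).
Proof.
move=> n_ge s_lt s5.
have by_summand a : a <= s -> a \in witness n -> s - a \in witness n ->
  s \in sumset (witness n) by apply: mem_sumset_sub.
have [s_lo|s_hi] := leqP s (n - 1).
  have [h|h] := boolP (s \in witness n).
    by apply: (by_summand 0); rewrite ?subn0 // mem_witness !inE; lia.
  (* The deleted points other than 5: shifting down by 1 or by 3 lands back in the set. *)
  have [?|?] : (s = 2 \/ s = 4 \/ s = n - 7 \/ s = n - 4) \/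
      (s = 6 \/ s = n - 6).
    by move: h; rewrite mem_witness !inE; lia.
  - by apply: (by_summand 1); rewrite ?mem_witness ?inE; lia.
  - by apply: (by_summand 3); rewrite ?mem_witness ?inE; lia.
have [->|[?|[?|?]]] : s = n + 3 \/
    ((s = n + 1 \/ s = n + 5 \/ s = 2 * n - 4 \/ s = 2 * n - 7) \/
    ((s = n + 4 \/ s = 2 * n - 8 \/ s = 2 * n - 6 \/ s = 2 * n - 5) \/
    ((s = n \/ s = n + 2 \/ s = 2 * n - 3 \/ s = 2 * n - 2) \/
     n + 6 <= s <= 2 * n - 9))) by lia.
(* The summands [n-1], [n-2], [n-3] would need the deleted 4, 5, 6, and [n-4] is itself deleted. The
   summand 8 lies below [n-7] because [16 <= n]. *)
- have -> : n + 3 = 8 + (n - 5) by lia.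
  by apply: mem_sumset; rewrite mem_witness !inE; lia.
- by apply: (by_summand (n - 2)); rewrite ?mem_witness ?inE; lia.
- by apply: (by_summand (n - 3)); rewrite ?mem_witness ?inE; lia.
- by apply: (by_summand (n - 1)); rewrite ?mem_witness ?inE; lia.
Qed.

Lemma witness_no_diff (n : nat) : 16 <= n -> ~ has_diff (witness n) (n - 7).
Proof. by move=> n_ge [a]; rewrite !mem_witness !inE; lia. Qed.

Lemma full_span_witness (n : nat) :
  16 <= n -> full_span_sum_dominant n (witness n).
Proof.
move=> n_ge.
have lt_n a : a \in witness n -> a < n by rewrite mem_witness => /andP[].
split=> //; try by rewrite mem_witness !inE; lia.
(* At least [2n-2] sums against at most [2n-3] differences. *)
have := @card_sumset_but_one (2 * n).-1 (witness n) 5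
  (fun x => witness_sum n x n_ge).
have : #|` diffset (witness n)| + 2 <= (2 * n).-1.
  by apply: (@card_diffset_lost n _ (n - 7) lt_n);
    [lia|exact: witness_no_diff].
by rewrite /sum_dominant; lia.
Qed.

(** * The largest cardinality: bound and existence *)

Lemma full_span_card_le (n : nat) (A : {fset nat}) :
  10 <= n -> full_span_sum_dominant n A -> #|` A| <= n - 4.
Proof.
move=> n_ge [ltA A0 A1 dom]; rewrite leqNgt; apply/negP => cardA.
exact: (@not_sum_dominant n A).
Qed.

(** Searching the power set of [[0, n-1]] makes the attainable cardinalities a boolean predicate
    bounded by [n], so [ex_maxnP] yields a maximum. *)
Lemma largest_card_exists (n : nat) (A : {fset nat}) :
  full_span_sum_dominant n A -> exists N, largest_card n N.
Proof.
move=> fsA.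
pose I := [fset x in iota 0 n]%fset.
pose P k := has (fun B : {fset nat} =>
  [&& 0 \in B, n.-1 \in B, #|` diffset B| < #|` sumset B| & #|` B| == k])
  (enum_fset (fpowerset I)).
have PP k : reflect (exists2 B, full_span_sum_dominant n B & #|` B| = k) (P k).
  apply: (iffP hasP) => [[B]|[B [ltB B0 B1 domB] cardB]].
    rewrite fpowersetE => /fsubsetP BI /and4P[B0 B1 domB /eqP cardB].
    by exists B => //; split=> // b /BI; rewrite !inE mem_iota.
  exists B; last by rewrite B0 B1 cardB eqxx andbT.
  by rewrite fpowersetE; apply/fsubsetP => b /ltB; rewrite !inE mem_iota.
have exP : exists k, P k by exists #|` A|; apply/PP; exists A.
have leP k : P k -> k <= n.
  move=> /PP[B [ltB _ _ _] <-]; rewrite -[leqRHS](size_iota 0).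
  by apply: uniq_leq_size (fset_uniq _) _ => b /ltB; rewrite mem_iota.
case: (ex_maxnP exP leP) => N /PP exN maxN.
by exists N; split=> // B fsB; apply: maxN; apply/PP; exists B.
Qed.

Theorem theorem2 (n : nat) (hn : (16 <= n)%N) :
  (exists N : nat, largest_card n N) /\
  (forall N : nat, largest_card n N -> (n - 7 <= N)%N /\ (N <= n - 4)%N).
Proof.
have fsW := full_span_witness n hn.
split; first exact: largest_card_exists fsW.
move=> N [[A fsA <-] maxN]; split.
  exact: leq_trans (card_witness n) (maxN _ fsW).
by apply: full_span_card_le fsA; lia.
Qed.
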